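(* Let $\Gamma\rightrightarrows X$ be a groupoid. Then there exist a group $G$ and a partial action $\theta$ of $G$ on $X$ such that $\Psi(\theta)\cong\Gamma$ as groupoids.
   Context: Partial action: $\theta=(G,X,\{X_g\},\{\theta_g\})$ of a group $G$ on a set $X$ consists of subsets $X_g\subseteq X$ and bijections $\theta_g:X_{g^{-1}}\to X_g$ ($g\in G$) such that (i) $X_1=X$, $\theta_1=1_X$; (ii) $\theta_g(X_{g^{-1}}\cap X_{g^{-1}h})\subseteq X_g\cap X_h$; (iii) $\theta_g\theta_h(x)=\theta_{gh}(x)$ for $x\in X_{h^{-1}}\cap X_{h^{-1}g^{-1}}$. Partial action groupoid $\Psi(\theta)$: object set $X$, arrows $(\theta_g(x),g,x)$ with $g\in G$, $x\in X_{g^{-1}}$, source $x$, target $\theta_g(x)$, composition $(\theta_g(y),g,y)(\theta_h(x),h,x)=(\theta_{gh}(x),gh,x)$ when $y=\theta_h(x)$, units $(x,1,x)$. $\Gamma\rightrightarrows X$ denotes a (small) groupoid with set of arrows $\Gamma$ and set of objects $X$. *)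

(* Defs.v *)
From HB Require Import structures.
From mathcomp Require Import all_boot.
From mathcomp Require Import boolp classical_sets functions.

Set Implicit Arguments.
Unset Strict Implicit.
Unset Printing Implicit Defensive.

Local Open Scope classical_set_scope.
Local Open Scope group_scope.

(* [groupoid A X] is a groupoid with arrows [A] and objects [X]. The composite *)
(* [gcomp a b e] is "a after b". Composability proofs are universally          *)
(* quantified in the axioms; those of composites exist by [gsrc_comp] and      *)
(* [gtgt_comp].                                                                *)
Record groupoid (A X : Type) := Groupoid {
  gsrc : A -> X;
  gtgt : A -> X;
  gunit : X -> A;
  ginv : A -> A;
  gcomp : forall a b : A, gsrc a = gtgt b -> A;
  gsrc_unit : forall x, gsrc (gunit x) = x;
  gtgt_unit : forall x, gtgt (gunit x) = x;
  gsrc_inv : forall a, gsrc (ginv a) = gtgt a;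
  gtgt_inv : forall a, gtgt (ginv a) = gsrc a;
  gsrc_comp : forall a b (e : gsrc a = gtgt b), gsrc (gcomp e) = gsrc b;
  gtgt_comp : forall a b (e : gsrc a = gtgt b), gtgt (gcomp e) = gtgt a;
  gcompA : forall a b c (ab : gsrc a = gtgt b) (bc : gsrc b = gtgt c)
      (a_bc : gsrc a = gtgt (gcomp bc)) (ab_c : gsrc (gcomp ab) = gtgt c),
    gcomp a_bc = gcomp ab_c;
  gcomp1a : forall a (e : gsrc (gunit (gtgt a)) = gtgt a), gcomp e = a;
  gcompa1 : forall a (e : gsrc a = gtgt (gunit (gsrc a))), gcomp e = a;
  gcompVa : forall a (e : gsrc (ginv a) = gtgt a), gcomp e = gunit (gsrc a);
  gcompaV : forall a (e : gsrc a = gtgt (ginv a)), gcomp e = gunit (gtgt a)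
}.

Record groupoid_functor A X B Y (Gam : groupoid A X) (Del : groupoid B Y) :=
  GroupoidFunctor {
    fobj : X -> Y;
    farr : A -> B;
    fsrc : forall a, gsrc Del (farr a) = fobj (gsrc Gam a);
    ftgt : forall a, gtgt Del (farr a) = fobj (gtgt Gam a);
    funit : forall x, farr (gunit Gam x) = gunit Del (fobj x);
    fcomp : forall a b (e : gsrc Gam a = gtgt Gam b)
        (fe : gsrc Del (farr a) = gtgt Del (farr b)),
      farr (gcomp e) = gcomp fe
  }.

Definition groupoid_isomorphic A X B Y
    (Gam : groupoid A X) (Del : groupoid B Y) : Prop :=
  exists (F : groupoid_functor Gam Del) (K : groupoid_functor Del Gam),
    [/\ cancel (fobj F) (fobj K), cancel (fobj K) (fobj F),
        cancel (farr F) (farr K) & cancel (farr K) (farr F)].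

(* The bijection from X_{g^-1} to X_g is represented by a total function       *)
(* [pa_fun g] whose values outside [pa_dom g^-1] are never used.               *)
Record partial_action (G : groupType) (X : Type) := PartialAction {
  pa_dom : G -> set X;
  pa_fun : G -> X -> X;
  pa_bij : forall g, set_bij (pa_dom g^-1) (pa_dom g) (pa_fun g);
  pa_dom1 : pa_dom 1 = [set: X];
  pa_fun1 : forall x, pa_fun 1 x = x;
  pa_sub : forall g h,
    pa_fun g @` (pa_dom g^-1 `&` pa_dom (g^-1 * h)) `<=` pa_dom g `&` pa_dom h;
  pa_funM : forall g h x, (pa_dom h^-1 `&` pa_dom (h^-1 * g^-1)) x ->
    pa_fun g (pa_fun h x) = pa_fun (g * h) x
}.

Section PartialActionGroupoid.
Variables (G : groupType) (X : Type) (theta : partial_action G X).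
Local Notation D := (pa_dom theta).
Local Notation t := (pa_fun theta).

(* The triples (theta_g(x), g, x) with x in X_{g^-1}. *)
Record pag_arrow := PagArrow {
  pag_tgt : X;
  pag_elt : G;
  pag_src : X;
  pag_srcP : D pag_elt^-1 pag_src;
  pag_tgtE : pag_tgt = t pag_elt pag_src
}.

Lemma pag_arrow_eq (a b : pag_arrow) :
  pag_elt a = pag_elt b -> pag_src a = pag_src b -> a = b.
Proof.
case: a b => [y g x Dx Ey] [y' g' x' Dx' Ey'] /= eg ex; subst.
by congr PagArrow; apply: Prop_irrelevance.
Qed.

Lemma pa_funV g x : D g^-1 x -> t g^-1 (t g x) = x.
Proof.
move=> Dx; rewrite pa_funM ?mulVg ?pa_fun1//.
by split=> //; rewrite mulgV pa_dom1.
Qed.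

Lemma pa_fun_in g x : D g^-1 x -> D g (t g x).
Proof. by case: (pa_bij theta g) => + _ _; apply. Qed.

Lemma pag_unit_subproof x : D 1^-1 x.
Proof. by rewrite invg1 pa_dom1. Qed.

Definition pag_unit (x : X) : pag_arrow :=
  PagArrow (pag_unit_subproof x) (esym (pa_fun1 theta x)).

Lemma pag_inv_dom (a : pag_arrow) : D (pag_elt a)^-1^-1 (pag_tgt a).
Proof. by case: a => y g x Dx /= ->; rewrite invgK; apply: pa_fun_in. Qed.

Lemma pag_inv_tgt (a : pag_arrow) : pag_src a = t (pag_elt a)^-1 (pag_tgt a).
Proof. by case: a => y g x Dx /= ->; rewrite pa_funV. Qed.

Definition pag_inv (a : pag_arrow) : pag_arrow :=
  PagArrow (pag_inv_dom a) (pag_inv_tgt a).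

Lemma pag_comp_dom_aux (a b : pag_arrow) : pag_src a = pag_tgt b ->
  D ((pag_elt b)^-1 * (pag_elt a)^-1) (pag_src b).
Proof.
case: a b => [z g y Dy Ez] [y' h x Dx Ey] /= e; subst.
have := @pa_sub _ _ theta h^-1 (h^-1 * g^-1) x; case=> //.
exists (t h x); last exact: pa_funV.
by rewrite invgK mulgA mulgV mul1g; split=> //; apply: pa_fun_in.
Qed.

Lemma pag_comp_dom (a b : pag_arrow) : pag_src a = pag_tgt b ->
  D (pag_elt a * pag_elt b)^-1 (pag_src b).
Proof. by rewrite invgM; apply: pag_comp_dom_aux. Qed.

Definition pag_comp (a b : pag_arrow) (e : pag_src a = pag_tgt b) : pag_arrow :=
  PagArrow (pag_comp_dom e)
    (erefl (t (pag_elt a * pag_elt b) (pag_src b))).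

Lemma pag_comp_tgtE (a b : pag_arrow) (e : pag_src a = pag_tgt b) :
  pag_tgt (pag_comp e) = pag_tgt a.
Proof.
rewrite /= (pag_tgtE a) e (pag_tgtE b) pa_funM //; split.
  exact: pag_srcP.
exact: pag_comp_dom_aux.
Qed.

Lemma pag_compA (a b c : pag_arrow) (ab : pag_src a = pag_tgt b)
    (bc : pag_src b = pag_tgt c) (a_bc : pag_src a = pag_tgt (pag_comp bc))
    (ab_c : pag_src (pag_comp ab) = pag_tgt c) :
  pag_comp a_bc = pag_comp ab_c.
Proof. by apply: pag_arrow_eq => //=; rewrite mulgA. Qed.

Lemma pag_comp1a (a : pag_arrow)
  (e : pag_src (pag_unit (pag_tgt a)) = pag_tgt a) : pag_comp e = a.
Proof. by apply: pag_arrow_eq => //=; rewrite mul1g. Qed.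

Lemma pag_compa1 (a : pag_arrow)
  (e : pag_src a = pag_tgt (pag_unit (pag_src a))) : pag_comp e = a.
Proof. by apply: pag_arrow_eq => //=; rewrite mulg1. Qed.

Lemma pag_compVa (a : pag_arrow) (e : pag_src (pag_inv a) = pag_tgt a) :
  pag_comp e = pag_unit (pag_src a).
Proof. by apply: pag_arrow_eq => //=; rewrite mulVg. Qed.

Lemma pag_compaV (a : pag_arrow) (e : pag_src a = pag_tgt (pag_inv a)) :
  pag_comp e = pag_unit (pag_tgt a).
Proof. by apply: pag_arrow_eq => //=; rewrite mulgV. Qed.

Definition partial_action_groupoid : groupoid pag_arrow X :=
  @Groupoid pag_arrow X pag_src pag_tgt pag_unit pag_inv pag_comp
    (fun=> erefl) (fun=> erefl) (fun=> erefl) (fun=> erefl)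
    (fun _ _ _ => erefl) pag_comp_tgtE pag_compA
    pag_comp1a pag_compa1 pag_compVa pag_compaV.

End PartialActionGroupoid.

(* Main.v *)
From HB Require Import structures.
Require Import Defs.
From mathcomp Require Import all_boot.
From mathcomp Require Import boolp classical_sets functions.

(** A functor [lam] from [Gam] to a group [G] that is injective on each set of
    arrows with a common source determines a partial action of [G] on the
    objects: [X_g] is the set of targets of the arrows labelled [g], and
    [theta_g] moves the source of such an arrow to its target.  The groupoid of
    this partial action is [Gam], since an arrow is recovered from its label and
    its source.

    Such a functor into a permutation group always exists.  Choose a base point
    in every component and an arrow from it to each object; conjugating by these
    arrows turns every arrow into a loop at a base point, and loops act on the
    arrows ending at their base point.  This separates parallel arrows.
    Acting in addition on subsets of [X] by symmetric difference with the source
    and the target separates arrows with different targets. *)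

Set Implicit Arguments.
Unset Strict Implicit.
Unset Printing Implicit Defensive.

Local Open Scope classical_set_scope.
Local Open Scope group_scope.

(** * The group of permutations of a type *)

Section Permutations.
Variable T : Type.

(** The inverse is stored as data, so inversion in the group just swaps the two maps; it is still
    determined by [pfwd]. *)
Record permutation := Permutation {
  pfwd : T -> T;
  pbwd : T -> T;
  pfwdK : cancel pfwd pbwd;
  pbwdK : cancel pbwd pfwd
}.

Lemma permutation_eq (p q : permutation) : pfwd p =1 pfwd q -> p = q.
Proof.
case: p q => [f f' fK f'K] [g g' gK g'K] /= /funext efg; subst g.
have efg' : f' = g' by apply/funext => x; rewrite -{1}(g'K x) fK.
by subst g'; congr Permutation; apply: Prop_irrelevance.
Qed.

HB.instance Definition _ := gen_eqMixin permutation.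
HB.instance Definition _ := gen_choiceMixin permutation.

Definition perm_one : permutation := @Permutation id id (frefl _) (frefl _).

Definition perm_inv (p : permutation) : permutation :=
  Permutation (@pbwdK p) (@pfwdK p).

Definition perm_mul (p q : permutation) : permutation :=
  Permutation (can_comp (@pfwdK p) (@pfwdK q))
              (can_comp (@pbwdK q) (@pbwdK p)).

Lemma perm_mulA : associative perm_mul.
Proof. by move=> p q r; apply: permutation_eq. Qed.

Lemma perm_mul1 : left_id perm_one perm_mul.
Proof. by move=> p; apply: permutation_eq. Qed.

Lemma perm_mulr1 : right_id perm_one perm_mul.
Proof. by move=> p; apply: permutation_eq. Qed.

Lemma perm_mulV : left_inverse perm_one perm_inv perm_mul.
Proof. by move=> p; apply: permutation_eq => x /=; rewrite pfwdK. Qed.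

Lemma perm_mulrV : right_inverse perm_one perm_inv perm_mul.
Proof. by move=> p; apply: permutation_eq => x /=; rewrite pbwdK. Qed.

HB.instance Definition _ := isGroup.Build permutation
  perm_mulA perm_mul1 perm_mulr1 perm_mulV perm_mulrV.

End Permutations.

(** * The partial action of a star-injective labelling *)

Section StarInjectiveLabelling.
Variables (A X : Type) (Gam : groupoid A X) (G : groupType) (lam : A -> G).
Local Notation src := (gsrc Gam).
Local Notation tgt := (gtgt Gam).
Hypothesis lamM : forall a b (e : src a = tgt b), lam (gcomp e) = lam a * lam b.
Hypothesis lam_inj : forall a b, src a = src b -> lam a = lam b -> a = b.

(** A unit composed with itself is itself, so its label is an idempotent of a group. *)
Lemma label_unit x : lam (gunit Gam x) = 1.
Proof.
set u := gunit Gam x.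
have e : src u = tgt u by rewrite gsrc_unit gtgt_unit.
have uE : gunit Gam (tgt u) = u by rewrite gtgt_unit.
have := @gcomp1a _ _ Gam u; rewrite uE => /(_ e) uu.
by apply: (mulgI (lam u)); rewrite mulg1 -(lamM e) uu.
Qed.

Lemma label_inv a : lam (ginv Gam a) = (lam a)^-1.
Proof.
have e : src (ginv Gam a) = tgt a by rewrite gsrc_inv.
by apply: (mulIg (lam a)); rewrite mulVg -(lamM e) gcompVa label_unit.
Qed.

Definition label_dom (g : G) : set X := [set x | exists a, lam a = g /\ tgt a = x].

(** By [lam_inj] at most one arrow out of [x] is labelled [g], so the choice made by [cid] is
    forced. The value [x] in the other case is junk. *)
Definition label_fun (g : G) (x : X) : X :=
  if pselect (exists a, lam a = g /\ src a = x) is left h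
  then tgt (sval (cid h)) else x.

Lemma label_domV g x : label_dom g^-1 x <-> exists a, lam a = g /\ src a = x.
Proof.
split=> -[a [ea ax]]; exists (ginv Gam a).
  by rewrite label_inv ea invgK gsrc_inv.
by rewrite label_inv ea gtgt_inv.
Qed.

Lemma label_funE a : label_fun (lam a) (src a) = tgt a.
Proof.
rewrite /label_fun; case: pselect => [h|]; last by case; exists a.
by case: cid => b [eb sb] /=; rewrite (lam_inj sb eb).
Qed.

Lemma label_bij g : set_bij (label_dom g^-1) (label_dom g) (label_fun g).
Proof.
split.
- by move=> x /label_domV[a [<- <-]]; rewrite label_funE; exists a.
- move=> x y /set_mem/label_domV[a [<- <-]] /set_mem/label_domV[b [eb <-]].
  rewrite label_funE -eb label_funE => eab.
  (* Injectivity on arrows with a common target follows from [lam_inj] by inversion: the inverses of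
     [a] and [b] share source and label. *)
  have /(congr1 (gtgt Gam)) : ginv Gam a = ginv Gam b.
    by apply: lam_inj; rewrite ?gsrc_inv // !label_inv eb.
  by rewrite !gtgt_inv.
- move=> y [a [<- <-]]; exists (src a); last exact: label_funE.
  by apply/label_domV; exists a.
Qed.

Lemma label_dom1 : label_dom 1 = [set: X].
Proof.
apply/seteqP; split=> // x _; exists (gunit Gam x).
by rewrite label_unit gtgt_unit.
Qed.

Lemma label_fun1 x : label_fun 1 x = x.
Proof.
by have := label_funE (gunit Gam x); rewrite label_unit gsrc_unit gtgt_unit.
Qed.

Lemma label_sub g h :
  label_fun g @` (label_dom g^-1 `&` label_dom (g^-1 * h))
    `<=` label_dom g `&` label_dom h.
Proof.
move=> _ [x [/label_domV[a [<- <-]] [b [eb tb]]] <-]; rewrite label_funE.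
split; first by exists a.
(* The arrow [b] labelled [g^-1 * h] ends where [a] starts; following it by [a] gives the label
   [h]. *)
exists (gcomp (esym tb)); split; last exact: gtgt_comp.
by rewrite lamM eb mulVKg.
Qed.

Lemma label_funM g h x : (label_dom h^-1 `&` label_dom (h^-1 * g^-1)) x ->
  label_fun g (label_fun h x) = label_fun (g * h) x.
Proof.
rewrite -invgM => -[/label_domV[b [<- <-]] /label_domV[c [ec sc]]].
(* Both [b], labelled [h], and [c], labelled [g * h], start at [x]; hence [c] after the inverse of
   [b] is labelled [g] and leads from the target of [b] to that of [c]. *)
have e : src c = tgt (ginv Gam b) by rewrite gtgt_inv.
have eg : lam (gcomp e) = g by rewrite lamM label_inv ec mulgK.
have es : src (gcomp e) = tgt b by rewrite gsrc_comp gsrc_inv.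
by rewrite label_funE -ec -sc label_funE -eg -es label_funE gtgt_comp.
Qed.

Definition label_action : partial_action G X :=
  PartialAction label_bij label_dom1 label_fun1 label_sub label_funM.

(** * Isomorphism with the groupoid of the action *)

Local Notation Psi := (partial_action_groupoid label_action).

Lemma pag_arrow_label (p : pag_arrow label_action) :
  exists a, lam a = pag_elt p /\ src a = pag_src p.
Proof. exact: (label_domV _ _).1 (pag_srcP p). Qed.

Definition unlabel_arrow (p : pag_arrow label_action) : A :=
  sval (cid (pag_arrow_label p)).

Lemma lam_unlabel p : lam (unlabel_arrow p) = pag_elt p.
Proof. by rewrite /unlabel_arrow; case: cid => a []. Qed.

Lemma src_unlabel p : src (unlabel_arrow p) = pag_src p.
Proof. by rewrite /unlabel_arrow; case: cid => a []. Qed.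

Lemma tgt_unlabel p : tgt (unlabel_arrow p) = pag_tgt p.
Proof. by rewrite -label_funE lam_unlabel src_unlabel (pag_tgtE p). Qed.

Lemma unlabel_unit x : unlabel_arrow (gunit Psi x) = gunit Gam x.
Proof.
by apply: lam_inj; rewrite ?src_unlabel ?lam_unlabel ?gsrc_unit ?label_unit.
Qed.

Lemma unlabel_comp (p q : pag_arrow label_action) (e : gsrc Psi p = gtgt Psi q)
    (fe : src (unlabel_arrow p) = tgt (unlabel_arrow q)) :
  unlabel_arrow (gcomp e) = gcomp fe.
Proof.
by apply: lam_inj; rewrite ?gsrc_comp ?lamM ?src_unlabel ?lam_unlabel.
Qed.

Definition unlabel_functor : groupoid_functor Psi Gam :=
  @GroupoidFunctor _ _ _ _ Psi Gam id unlabel_arrow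
    src_unlabel tgt_unlabel unlabel_unit unlabel_comp.

Lemma label_arrow_dom a : pa_dom label_action (lam a)^-1 (src a).
Proof. by apply/label_domV; exists a. Qed.

Definition label_arrow (a : A) : pag_arrow label_action :=
  PagArrow (label_arrow_dom a) (esym (label_funE a)).

Lemma label_arrow_unit x : label_arrow (gunit Gam x) = gunit Psi x.
Proof. by apply: pag_arrow_eq; rewrite /= ?label_unit ?gsrc_unit. Qed.

Lemma label_arrow_comp a b (e : src a = tgt b)
    (fe : gsrc Psi (label_arrow a) = gtgt Psi (label_arrow b)) :
  label_arrow (gcomp e) = gcomp fe.
Proof. by apply: pag_arrow_eq; rewrite /= ?lamM ?gsrc_comp. Qed.

Definition label_functor : groupoid_functor Gam Psi :=
  @GroupoidFunctor _ _ _ _ Gam Psi id label_arrow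
    (fun=> erefl) (fun=> erefl) label_arrow_unit label_arrow_comp.

Lemma label_action_isomorphic : groupoid_isomorphic Psi Gam.
Proof.
exists unlabel_functor, label_functor; split=> // [p|a] /=.
  by apply: pag_arrow_eq; rewrite /= ?lam_unlabel ?src_unlabel.
by apply: lam_inj; rewrite ?lam_unlabel ?src_unlabel.
Qed.

End StarInjectiveLabelling.

(** * A star-injective functor to a permutation group *)

Section StarInjectiveFunctor.
Variables (A X : Type) (Gam : groupoid A X).
Local Notation src := (gsrc Gam).
Local Notation tgt := (gtgt Gam).
Local Notation inv := (ginv Gam).
Local Notation unit := (gunit Gam).

(* The junk value [b] makes left composition with a loop a permutation of all
   arrows, trivial on those that do not end at its base point. *)
Definition tcomp (a b : A) : A :=
  if pselect (src a = tgt b) is left e then gcomp e else b.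

Local Infix "**" := tcomp (at level 40, left associativity).

Lemma tcompE a b (e : src a = tgt b) : a ** b = gcomp e.
Proof.
rewrite /tcomp; case: pselect => // e'.
by rewrite (Prop_irrelevance e e').
Qed.

Lemma tcomp_out a b : src a <> tgt b -> a ** b = b.
Proof. by rewrite /tcomp; case: pselect. Qed.

Lemma src_tcomp a b : src (a ** b) = src b.
Proof. by rewrite /tcomp; case: pselect => // e; rewrite gsrc_comp. Qed.

Lemma tgt_tcomp a b : src a = tgt b -> tgt (a ** b) = tgt a.
Proof. by move=> e; rewrite (tcompE e) gtgt_comp. Qed.

Lemma tcompA a b c : src a = tgt b -> src b = tgt c ->
  a ** (b ** c) = a ** b ** c.
Proof.
move=> ab bc; rewrite (tcompE ab) (tcompE bc).
have a_bc : src a = tgt (gcomp bc) by rewrite gtgt_comp.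
have ab_c : src (gcomp ab) = tgt c by rewrite gsrc_comp.
by rewrite (tcompE a_bc) (tcompE ab_c); apply: gcompA.
Qed.

(** If [c] does not end at the base point of the loop [b], neither [b] nor [a] composes with it, and
    both sides are [c]. *)
Lemma tcompA_loop a b c : src a = tgt b -> src b = tgt b ->
  a ** (b ** c) = a ** b ** c.
Proof.
move=> ab bb; case: (pselect (src b = tgt c)) => [|nbc]; first exact: tcompA.
by rewrite !(@tcomp_out _ c) ?src_tcomp // ab -bb.
Qed.

Lemma tcomp1a x b : unit x ** b = b.
Proof.
case: (pselect (x = tgt b)) => [->|nxb]; last by rewrite tcomp_out ?gsrc_unit.
have e : src (unit (tgt b)) = tgt b by rewrite gsrc_unit.
by rewrite (tcompE e) gcomp1a.
Qed.

Lemma tcompa1 a : a ** unit (src a) = a.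
Proof.
have e : src a = tgt (unit (src a)) by rewrite gtgt_unit.
by rewrite (tcompE e) gcompa1.
Qed.

Lemma tcompVa a : inv a ** a = unit (src a).
Proof. by rewrite (tcompE (gsrc_inv Gam a)) gcompVa. Qed.

Lemma tcompaV a : a ** inv a = unit (tgt a).
Proof. by rewrite (tcompE (esym (gtgt_inv Gam a))) gcompaV. Qed.

Lemma tcompVK a b : tgt a = tgt b -> a ** (inv a ** b) = b.
Proof.
by move=> ab; rewrite tcompA ?gtgt_inv ?gsrc_inv // tcompaV tcomp1a.
Qed.

Lemma tcompK a b : src a = tgt b -> a ** b ** inv b = a.
Proof. by move=> ab; rewrite -tcompA ?gtgt_inv // tcompaV -ab tcompa1. Qed.

(** * Base points and conjugation to loops *)

Definition linked (x y : X) : Prop := exists a, src a = y /\ tgt a = x.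

Lemma linked_refl x : exists y, linked x y.
Proof. by exists x, (unit x); rewrite gsrc_unit gtgt_unit. Qed.

Definition base (x : X) : X := sval (cid (linked_refl x)).

(* [base] chooses from the predicate [linked x], which only depends on the
   component of [x]. *)
Lemma base_src_tgt a : base (src a) = base (tgt a).
Proof.
have E : linked (src a) = linked (tgt a).
  apply/predeqP => z; split=> -[b [sb tb]].
    by exists (a ** b); rewrite src_tcomp tgt_tcomp.
  by exists (inv a ** b); rewrite src_tcomp tgt_tcomp ?gtgt_inv ?gsrc_inv.
rewrite /base; move: (linked_refl (src a)) (linked_refl (tgt a)).
by rewrite E => h h'; rewrite (Prop_irrelevance h h').
Qed.

Lemma linked_base x : linked x (base x).
Proof. by rewrite /base; case: cid. Qed.

Definition path_to (x : X) : A := sval (cid (linked_base x)).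

Lemma src_path_to x : src (path_to x) = base x.
Proof. by rewrite /path_to; case: cid => a []. Qed.

Lemma tgt_path_to x : tgt (path_to x) = x.
Proof. by rewrite /path_to; case: cid => a []. Qed.

Definition loop_of (a : A) : A := inv (path_to (tgt a)) ** (a ** path_to (src a)).

Lemma src_loop_of a : src (loop_of a) = base (src a).
Proof. by rewrite !src_tcomp src_path_to. Qed.

Lemma tgt_loop_of a : tgt (loop_of a) = base (src a).
Proof.
rewrite tgt_tcomp ?gtgt_inv ?src_path_to ?base_src_tgt //.
by rewrite gsrc_inv tgt_tcomp tgt_path_to.
Qed.

(** The chosen path to the middle object meets its own inverse and cancels. *)
Lemma loop_of_tcomp a b : src a = tgt b ->
  loop_of (a ** b) = loop_of a ** loop_of b.
Proof.
move=> ab; have bc : src b = tgt (path_to (src b)) by rewrite tgt_path_to.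
have ac : src a = tgt (path_to (src a)) by rewrite tgt_path_to.
have cl : src (path_to (src a)) = tgt (loop_of b).
  by rewrite tgt_loop_of src_path_to ab base_src_tgt.
have tac : src (inv (path_to (tgt a))) = tgt (a ** path_to (src a)).
  by rewrite gsrc_inv tgt_path_to tgt_tcomp.
rewrite [loop_of a]/loop_of -(tcompA tac) ?src_tcomp // -(tcompA ac cl).
rewrite {1}/loop_of tgt_tcomp // src_tcomp -(tcompA ab bc).
by rewrite [loop_of b]/loop_of -ab tcompVK // tgt_path_to tgt_tcomp.
Qed.

(** Parallel arrows are conjugated by the same two paths, which can be cancelled on either side. *)
Lemma loop_of_inj a b : src a = src b -> tgt a = tgt b ->
  loop_of a = loop_of b -> a = b.
Proof.
move=> sab tab /(congr1 (tcomp (path_to (tgt a)))).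
rewrite /loop_of -tab -sab !tcompVK ?tgt_path_to ?tgt_tcomp ?tgt_path_to //.
move=> /(congr1 (tcomp^~ (inv (path_to (src a))))).
by rewrite /= !tcompK ?tgt_path_to.
Qed.

(** * The action on pairs of an arrow and a subset *)

Definition toggle (a : A) (S : X -> bool) : X -> bool :=
  fun z => S z (+) (`[< z = tgt a >] (+) `[< z = src a >]).

Definition arrow_fun (a : A) (bS : A * (X -> bool)) : A * (X -> bool) :=
  (loop_of a ** bS.1, toggle a bS.2).

Lemma arrow_fun_comp a b (e : src a = tgt b) bS :
  arrow_fun (gcomp e) bS = arrow_fun a (arrow_fun b bS).
Proof.
case: bS => c S; rewrite -tcompE; congr pair => /=.
  by rewrite loop_of_tcomp // -tcompA_loop // ?src_loop_of tgt_loop_of //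
     e -base_src_tgt.
(* The middle object is toggled twice, so it drops out. *)
apply/funext => z; rewrite /toggle tgt_tcomp // src_tcomp e.
by rewrite -!addbA; congr addb; rewrite [RHS]addbC -!addbA addbb addbF addbC.
Qed.

Lemma arrow_fun_unit x bS : arrow_fun (unit x) bS = bS.
Proof.
case: bS => c S; congr pair => /=.
  rewrite /loop_of gtgt_unit gsrc_unit tcomp1a tcompVa; exact: tcomp1a.
by apply/funext => z; rewrite /toggle gtgt_unit gsrc_unit addbb addbF.
Qed.

Lemma arrow_funK a : cancel (arrow_fun a) (arrow_fun (inv a)).
Proof.
move=> bS; rewrite -(arrow_fun_comp (gsrc_inv Gam a)) gcompVa.
exact: arrow_fun_unit.
Qed.

Lemma arrow_funVK a : cancel (arrow_fun (inv a)) (arrow_fun a).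
Proof.
move=> bS; rewrite -(arrow_fun_comp (esym (gtgt_inv Gam a))) gcompaV.
exact: arrow_fun_unit.
Qed.

Definition arrow_perm (a : A) : permutation (A * (X -> bool)) :=
  Permutation (arrow_funK a) (arrow_funVK a).

Lemma arrow_permM a b (e : src a = tgt b) :
  arrow_perm (gcomp e) = arrow_perm a * arrow_perm b.
Proof. by apply: permutation_eq => bS; apply: arrow_fun_comp. Qed.

Lemma arrow_perm_star_inj a b : src a = src b -> arrow_perm a = arrow_perm b ->
  a = b.
Proof.
(* Evaluate at the unit of the base point, which recovers the loop, and at the empty set, which
   recovers the target once the common source is cancelled. *)
move=> sab /(congr1 (@pfwd _)) /= /(congr1 (fun f =>
  f (unit (base (src a)), xpred0))) [el es].
apply: loop_of_inj => //.
  have := congr1 (fun S : X -> bool => S (tgt a)) es.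
  rewrite /toggle /= sab => /addIb; rewrite asboolT //.
  by move/esym/asboolP.
move: el; rewrite -{1}src_loop_of tcompa1.
by rewrite sab -src_loop_of tcompa1.
Qed.

End StarInjectiveFunctor.

Theorem proposition2p4 (A X : Type) (Gam : groupoid A X) :
  exists (G : groupType) (theta : partial_action G X),
    groupoid_isomorphic (partial_action_groupoid theta) Gam.
Proof.
exists (permutation (A * (X -> bool))).
exists (label_action (@arrow_permM _ _ Gam) (@arrow_perm_star_inj _ _ Gam)).
exact: label_action_isomorphic.
Qed.
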